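(* There is a functor from the category ${}_\prec\mathbf{D}_\vee\mathbf{P}$ to the category ${}_\cup\mathbf{B}$ given on objects by $S\mapsto(\widehat{S}_p)_{p\in S}$ (a $\cup$-basis of the spectrum $\widehat{S}$) and on morphisms by $\sqsubset\ \mapsto\phi_\sqsubset$, where for a morphism $\sqsubset\ \subseteq S\times S'$, $\phi_\sqsubset$ is the partial function from $\widehat{S}$ to $\widehat{S'}$ given by \[\phi_\sqsubset(P)=P^\sqsubset=\{p'\in S':\exists p\in P\ (p\sqsubset p')\}\qquad\text{on}\qquad\mathrm{dom}(\phi_\sqsubset)=\{P\in\widehat{S}:P^\sqsubset\neq\emptyset\}.\]
   Context: Order. $(S,\leq)$ is a $\vee$-semilattice (poset with binary joins $\vee$) with minimum $0$, equipped with a binary relation $\prec$. A filter is a non-empty $F\subseteq S$ such that for all $p,q\in S$: $p,q\in F$ iff there is $r\in F$ with $r\leq p,q$. An ideal is a non-empty $I\subseteq S$ such that for all $p,q\in S$: $p,q\in I$ iff there is $r\in I$ with $r\geq p,q$. A filter $P$ is prime if $S\setminus P$ is an ideal; proper if $P\neq S$; round if for every $p\in P$ there is $r\in P$ with $r\prec p$. The spectrum of $(S,\leq,\prec)$ is the set $\widehat{S}$ of all proper round prime filters, with the topology generated by the sets $\widehat{S}_p=\{P\in\widehat{S}:p\in P\}$, $p\in S$. $\prec$ is distributive if for all $p,s,t\in S$: $p\prec s\vee t$ implies that for every $p'\prec p$ there are $s'\prec s$ and $t'\prec t$ with $p'\leq s'\vee t'\leq p$. $\prec$ is auxiliary if for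 all $p,p',q,q'\in S$: $p\leq p'\prec q'\leq q$ implies $p\prec q$, and $p\prec q$ implies $p\leq q$. $\prec$ is interpolative if whenever $p\prec q$ there is $s\in S$ with $p\prec s\prec q$. $\prec$ is approximating if for all $p,q\in S$: $p\leq q$ iff $\{r\in S:r\prec p\}\subseteq\{r\in S:r\prec q\}$. $\prec$ is $\vee$-preserving if for all $p,p',q,q'\in S$: $p'\prec p$ and $q'\prec q$ imply $p'\vee q'\prec p\vee q$. $S$ is a $\prec$-distributive $\vee$-predomain if $\prec$ is distributive, auxiliary, approximating, interpolative and $\vee$-preserving. The category ${}_\prec\mathbf{D}_\vee\mathbf{P}$: objects are $\prec$-distributive $\vee$-predomains; a morphism from $S$ to $S'$ is a relation $\sqsubset\ \subseteq S\times S'$ such that (with primed elements in $S'$, unprimed in $S$): (Faithful) $p\sqsubset 0'$ implies $p=0$, where $0'$ is the minimum of $S'$; (Auxiliarity) $p\leq q\sqsubset q'\leq p'$ implies $p\sqsubset p'$; (Pushforward) if $p\prec q$, $q\sqsubset r'$ and $q\sqsubset s'$, then there is $p'\in S'$ with $p\sqsubset p'$, $p'\prec r'$ and $p'\prec s'$; ($\vee$-Pullback) if $p\prec q\sqsubset r'\vee s'$, then there are $r\sqsubset r'$ and $s\sqsubset s'$ with $p\prec r\vee s$. Composition is composition of relations: the composite of $\sqsubset\ \subseteq S\times S'$ followed by $\sqsubset'\ \subseteq S'\times S''$ is $\sqsubset\circ\sqsubset'$, where $p\sqsubset\circ\sqsubset'p''$ iff there is $p'\in S'$ with $p\sqsubset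 p'\sqsubset'p''$; the identity on $S$ is $\leq$. The category ${}_\cup\mathbf{B}$: objects are $\cup$-bases $S$ of core compact sober spaces $X$; a morphism from $S$ (basis of $X$) to $S'$ (basis of $X'$) is a partial function $\phi$ from $X$ to $X'$ such that $\phi^{-1}[p']=\bigcup\{p\in S:p\subseteq\phi^{-1}[p']\}$ for all $p'\in S'$ (i.e. a partial continuous function with open domain). Composition is composition of partial functions. Here a $\cup$-basis is a basis of the topology closed under finite unions, including the empty union; a space is core compact if for every point $x$ and open $O\ni x$ there is an open $N\ni x$ such that every open cover of $O$ has a finite subfamily covering $N$; it is sober if every non-empty irreducible closed set is the closure of a unique point. *)

(* Defs.v *)
From HB Require Import structures.
From mathcomp Require Import all_boot all_order.
From mathcomp Require Import all_classical topology_structure.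

Set Implicit Arguments.
Unset Strict Implicit.
Unset Printing Implicit Defensive.

Import Order.Theory Order.Syntax Order.LatticeSyntax.

Local Open Scope classical_set_scope.
Local Open Scope order_scope.

Section Filters.
Context {d : Order.disp_t} {S : bJoinSemilatticeType d}.
Implicit Types (F I P : set S) (prec : S -> S -> Prop).

Definition is_filter F :=
  F !=set0 /\
  forall p q, (F p /\ F q) <-> exists r, [/\ F r, r <= p & r <= q].

Definition is_ideal I :=
  I !=set0 /\
  forall p q, (I p /\ I q) <-> exists r, [/\ I r, p <= r & q <= r].

Definition is_prime_filter P := is_filter P /\ is_ideal (~` P).

Definition is_proper P := P <> [set: S].

Definition is_round prec P := forall p, P p -> exists2 r, P r & prec r p.

Definition prec_distributive prec := forall p s t, prec p (s `|` t) ->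
  forall p', prec p' p -> exists s' t',
    [/\ prec s' s, prec t' t, p' <= s' `|` t' & s' `|` t' <= p].

Definition prec_auxiliary prec :=
  (forall p p' q q', p <= p' -> prec p' q' -> q' <= q -> prec p q) /\
  (forall p q, prec p q -> p <= q).

Definition prec_interpolative prec :=
  forall p q, prec p q -> exists s, prec p s /\ prec s q.

Definition prec_approximating prec := forall p q,
  p <= q <-> ([set r | prec r p] `<=` [set r | prec r q])%classic.

Definition prec_join_preserving prec := forall p p' q q',
  prec p' p -> prec q' q -> prec (p' `|` q') (p `|` q).

End Filters.

Record predomain := Predomain {
  pd_disp : Order.disp_t;
  pd_sort :> bJoinSemilatticeType pd_disp;
  prec : pd_sort -> pd_sort -> Prop;
  prec_distr : prec_distributive prec;
  prec_aux : prec_auxiliary prec;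
  prec_approx : prec_approximating prec;
  prec_interp : prec_interpolative prec;
  prec_joinpres : prec_join_preserving prec }.

Arguments prec {_} _ _.
Notation "p ≺ q" := (prec p q) (at level 70, no associativity).

Record category := Category {
  obj :> Type;
  hom : obj -> obj -> Type;
  idm : forall A, hom A A;
  (* diagrammatic order: [compm f g] is [f] followed by [g] *)
  compm : forall A B C, hom A B -> hom B C -> hom A C;
  compm1l : forall A B (f : hom A B), compm (idm A) f = f;
  compm1r : forall A B (f : hom A B), compm f (idm B) = f;
  compmA : forall A B C D (f : hom A B) (g : hom B C) (h : hom C D),
    compm f (compm g h) = compm (compm f g) h }.

Arguments idm {_} A.
Arguments compm {_ A B C} f g.

Definition is_functor (C D : category) (Fo : C -> D)
    (Fm : forall A B : C, hom A B -> hom (Fo A) (Fo B)) : Prop :=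
  (forall A : C, Fm A A (idm A) = idm (Fo A)) /\
  (forall (A B E : C) (f : hom A B) (g : hom B E),
     Fm A E (compm f g) = compm (Fm A B f) (Fm B E g)).

Record is_pd_morphism (S S' : predomain) (R : S -> S' -> Prop) : Prop := {
  pdm_faithful : forall p, R p \bot -> p = \bot;
  pdm_auxiliary : forall p q q' p', p <= q -> R q q' -> q' <= p' -> R p p';
  pdm_pushforward : forall p q r' s', p ≺ q -> R q r' -> R q s' ->
    exists p', [/\ R p p', p' ≺ r' & p' ≺ s'];
  pdm_join_pullback : forall p q r' s', p ≺ q -> R q (r' `|` s') ->
    exists r s, [/\ R r r', R s s' & p ≺ r `|` s] }.

Record pd_morphism (S S' : predomain) := PdMorphism {
  pd_rel :> S -> S' -> Prop;
  pd_relP : is_pd_morphism pd_rel }.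

Lemma pd_morphism_eq (S S' : predomain) (f g : pd_morphism S S') :
  (forall p p', f p p' <-> g p p') -> f = g.
Proof.
case: f g => [f fP] [g gP] /= fg.
have E : f = g by apply/funext => p; apply/funext => p'; apply/propext.
by case: _ / E gP {fg} => gP; congr PdMorphism; exact: Prop_irrelevance.
Qed.

Definition comp_rel (A B C : Type) (f : A -> B -> Prop) (g : B -> C -> Prop) :=
  fun a c => exists b, f a b /\ g b c.

Lemma pd_id_subproof (S : predomain) :
  is_pd_morphism (fun p q : S => p <= q : Prop).
Proof.
have [aux auxle] := prec_aux S; split.
- by move=> p; rewrite lex0 => /eqP.
- by move=> p q q' p' pq qq' qp'; exact: le_trans pq (le_trans qq' qp').
- by move=> p q r s pq qr qs; exists p; split=> //;
    [exact: aux (lexx p) pq qr | exact: aux (lexx p) pq qs].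
- by move=> p q r s pq qrs; exists r, s; split=> //; exact: aux (lexx p) pq qrs.
Qed.

Lemma pd_comp_subproof (S S' S'' : predomain)
    (f : pd_morphism S S') (g : pd_morphism S' S'') :
  is_pd_morphism (comp_rel f g).
Proof.
have [Ff Af Pf Jf] := pd_relP f; have [Fg Ag Pg Jg] := pd_relP g.
have [aux auxle] := prec_aux S; have [aux' auxle'] := prec_aux S'.
split.
- by move=> p [p' [fp /Fg p'0]]; apply: Ff; rewrite -p'0.
- move=> p q q'' p'' pq [q' [fq gq]] qp; exists q'.
  by split; [exact: Af pq fq (lexx _) | exact: Ag (lexx _) gq qp].
- move=> p q r s pq [a [qa ar]] [b [qb bs]].
  have [p1 [pp1 p1q]] := prec_interp pq.
  have [c [p1c ca cb]] := Pf _ _ _ _ p1q qa qb.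
  have [e [pe ec _]] := Pf _ _ _ _ pp1 p1c p1c.
  have cr : g c r by exact: Ag (auxle' _ _ ca) ar (lexx _).
  have cs : g c s by exact: Ag (auxle' _ _ cb) bs (lexx _).
  have [u [eu ur us]] := Pg _ _ _ _ ec cr cs.
  by exists u; split=> //; exists e.
- move=> p q r s pq [a [qa ars]].
  have [p2 [pp2 p2q]] := prec_interp pq.
  have [b [p2b ba _]] := Pf _ _ _ _ p2q qa qa.
  have [c [e [cr es bce]]] := Jg _ _ _ _ ba ars.
  have p2ce : f p2 (c `|` e) by exact: Af (lexx _) p2b (auxle' _ _ bce).
  have [u [v [uc ve puv]]] := Jf _ _ _ _ pp2 p2ce.
  by exists u, v; split=> //; [exists c | exists e].
Qed.

Definition pd_id (S : predomain) : pd_morphism S S :=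
  PdMorphism (pd_id_subproof S).

Definition pd_comp (S S' S'' : predomain)
    (f : pd_morphism S S') (g : pd_morphism S' S'') : pd_morphism S S'' :=
  PdMorphism (pd_comp_subproof f g).

Lemma pd_comp1l (S S' : predomain) (f : pd_morphism S S') :
  pd_comp (pd_id S) f = f.
Proof.
apply: pd_morphism_eq => p p' /=; split; last by exists p.
by case=> q [pq qp']; exact: (pdm_auxiliary (pd_relP f)) pq qp' (lexx _).
Qed.

Lemma pd_comp1r (S S' : predomain) (f : pd_morphism S S') :
  pd_comp f (pd_id S') = f.
Proof.
apply: pd_morphism_eq => p p' /=; split; last by exists p'.
by case=> q [pq qp']; exact: (pdm_auxiliary (pd_relP f)) (lexx _) pq qp'.
Qed.

Lemma pd_compA (S1 S2 S3 S4 : predomain) (f : pd_morphism S1 S2)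
    (g : pd_morphism S2 S3) (h : pd_morphism S3 S4) :
  pd_comp f (pd_comp g h) = pd_comp (pd_comp f g) h.
Proof.
apply: pd_morphism_eq => p p' /=; split.
- by case=> a [pa [b [ab bp]]]; exists b; split=> //; exists a.
- by case=> b [[a [pa ab]] bp]; exists a; split=> //; exists b.
Qed.

Definition DvP : category := Category pd_comp1l pd_comp1r pd_compA.

Definition core_compact (X : topologicalType) :=
  forall (x : X) (O : set X), open O -> O x ->
  exists N : set X, [/\ open N, N x &
    forall U : set (set X), (U `<=` open)%classic ->
      (O `<=` \bigcup_(A in U) A)%classic ->
      exists V : set (set X), [/\ finite_set V, (V `<=` U)%classic &
        (N `<=` \bigcup_(A in V) A)%classic]].

Definition irreducible_set (X : topologicalType) (C : set X) :=
  forall A B : set X, closed A -> closed B ->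
  (C `<=` A `|` B)%classic -> (C `<=` A)%classic \/ (C `<=` B)%classic.

Definition sober (X : topologicalType) :=
  forall C : set X, closed C -> C !=set0 -> irreducible_set C ->
  exists! x : X, C = closure [set x].

(* The empty union is the case [F = set0]. *)
Definition cup_basis (X : topologicalType) (B : set (set X)) :=
  basis B /\
  forall F : set (set X), finite_set F -> (F `<=` B)%classic ->
    B (\bigcup_(A in F) A)%classic.

Record is_cup_base (X : topologicalType) (B : set (set X)) : Prop := {
  cb_core_compact : core_compact X;
  cb_sober : sober X;
  cb_cup_basis : cup_basis B }.

Record cup_base := CupBase {
  cb_space : topologicalType;
  cb_sets : set (set cb_space);
  cb_prop : is_cup_base cb_sets }.

Definition pdom (X Y : Type) (f : X -> option Y) : set X :=
  [set x | exists y, f x = Some y].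

Definition ppreimage (X Y : Type) (f : X -> option Y) (A : set Y) : set X :=
  [set x | exists2 y, f x = Some y & A y].

(* Equivalently, [ppreimage f q] is open for every [q] in the target base
   (lemma [is_cb_morphismP]); hence [pdom f], the union of these preimages,
   is open too. *)
Definition is_cb_morphism (S S' : cup_base)
    (f : cb_space S -> option (cb_space S')) : Prop :=
  forall q : set (cb_space S'), cb_sets q ->
  ppreimage f q =
    (\bigcup_(p in [set p | cb_sets p /\ p `<=` ppreimage f q]) p)%classic.

Record cb_morphism (S S' : cup_base) := CbMorphism {
  cb_fun :> cb_space S -> option (cb_space S');
  cb_funP : is_cb_morphism cb_fun }.

Lemma cb_morphism_eq (S S' : cup_base) (f g : cb_morphism S S') :
  (forall x, f x = g x) -> f = g.
Proof.
case: f g => [f fP] [g gP] /= fg.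
have E : f = g by apply/funext.
by case: _ / E gP {fg} => gP; congr CbMorphism; exact: Prop_irrelevance.
Qed.

Lemma cb_basisP (S : cup_base) (A : set (cb_space S)) x : open A -> A x ->
  exists p, [/\ cb_sets p, p x & (p `<=` A)%classic].
Proof.
move=> oA Ax; have [_ /(_ x)] := (cb_cup_basis (cb_prop S)).1.
move=> /(_ A (open_nbhs_nbhs (conj oA Ax))).
by case=> p [Bp px] pA; exists p.
Qed.

Lemma cb_sets_open (S : cup_base) (p : set (cb_space S)) :
  cb_sets p -> open p.
Proof. by have [+ _] := (cb_cup_basis (cb_prop S)).1; exact. Qed.

Lemma is_cb_morphismP (S S' : cup_base)
    (f : cb_space S -> option (cb_space S')) :
  is_cb_morphism f <-> (forall q, cb_sets q -> open (ppreimage f q)).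
Proof.
split=> fP q Bq.
  rewrite (fP q Bq); apply: bigcup_open => p [Bp _]; exact: cb_sets_open.
apply/seteqP; split=> [x|x [p [_ sub] px]]; last exact: sub.
by move=> /(cb_basisP (fP q Bq))[p [Bp px sub]]; exists p.
Qed.

Lemma cb_morphism_open (S S' : cup_base) (f : cb_morphism S S') A :
  open A -> open (ppreimage f A).
Proof.
move=> oA; have fP := (is_cb_morphismP f).1 (cb_funP f).
suff -> : ppreimage f A =
    (\bigcup_(q in [set q | cb_sets q /\ q `<=` A]) ppreimage f q)%classic.
  by apply: bigcup_open => q [Bq _]; exact: fP.
apply/seteqP; split=> [x [y fx Ay]|x [q [_ qA] [y fx qy]]].
  by have [q [Bq qy qA]] := cb_basisP oA Ay; exists q => //; exists y.
by exists y => //; exact: qA.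
Qed.

Lemma cb_id_subproof (S : cup_base) :
  is_cb_morphism (Some : cb_space S -> option (cb_space S)).
Proof.
apply/is_cb_morphismP => q Bq.
rewrite (_ : ppreimage _ q = q); first exact: cb_sets_open.
by apply/seteqP; split=> [x [y [->]]|x qx] //; exists x.
Qed.

Lemma cb_comp_subproof (S S' S'' : cup_base)
    (f : cb_morphism S S') (g : cb_morphism S' S'') :
  is_cb_morphism (fun x => obind g (f x)).
Proof.
apply/is_cb_morphismP => q Bq.
have := (is_cb_morphismP g).1 (cb_funP g) q Bq => /(cb_morphism_open f).
rewrite (_ : ppreimage (fun x => _) q = ppreimage f (ppreimage g q)) //.
apply/seteqP; split=> [x [z]|x [y fx [z gy qz]]]; last by exists z; rewrite ?fx.
by case fx: (f x) => [y|//] /= gy qz; exists y => //; exists z.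
Qed.

Definition cb_id (S : cup_base) : cb_morphism S S :=
  CbMorphism (@cb_id_subproof S).

Definition cb_comp (S S' S'' : cup_base)
    (f : cb_morphism S S') (g : cb_morphism S' S'') : cb_morphism S S'' :=
  CbMorphism (cb_comp_subproof f g).

Lemma cb_comp1l (S S' : cup_base) (f : cb_morphism S S') :
  cb_comp (cb_id S) f = f.
Proof. exact: cb_morphism_eq. Qed.

Lemma cb_comp1r (S S' : cup_base) (f : cb_morphism S S') :
  cb_comp f (cb_id S') = f.
Proof. by apply: cb_morphism_eq => x /=; case: (f x). Qed.

Lemma cb_compA (S1 S2 S3 S4 : cup_base) (f : cb_morphism S1 S2)
    (g : cb_morphism S2 S3) (h : cb_morphism S3 S4) :
  cb_comp f (cb_comp g h) = cb_comp (cb_comp f g) h.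
Proof. by apply: cb_morphism_eq => x /=; case: (f x). Qed.

Definition CupB : category := Category cb_comp1l cb_comp1r cb_compA.

Record in_spectrum (S : predomain) (P : set S) : Prop := {
  spec_prime : is_prime_filter P;
  spec_proper : is_proper P;
  spec_round : is_round prec P }.

Definition spectrum (S : predomain) : Type := {P : set S | in_spectrum P}.

Definition spec_set (S : predomain) (P : spectrum S) : set S := proj1_sig P.

Definition spec_open (S : predomain) (p : S) : set (spectrum S) :=
  [set P | spec_set P p].

Definition spec_basis (S : predomain) : set (set (spectrum S)) :=
  range (@spec_open S).

HB.instance Definition _ (S : predomain) := gen_eqMixin (spectrum S).
HB.instance Definition _ (S : predomain) := gen_choiceMixin (spectrum S).
HB.instance Definition _ (S : predomain) :=
  isSubBaseTopological.Build (spectrum S) (@spec_basis S) id.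

Definition spec_obj
    (H : forall S : predomain, is_cup_base (@spec_basis S)) (S : DvP) : CupB :=
  CupBase (H S).

(* P^⊏, for [R] the relation ⊏ *)
Definition push (S S' : predomain) (R : S -> S' -> Prop) (P : set S) : set S' :=
  [set p' | exists2 p, P p & R p p'].

Definition is_phi (S S' : predomain) (R : S -> S' -> Prop)
    (f : spectrum S -> option (spectrum S')) : Prop :=
  pdom f = [set P | push R (spec_set P) !=set0] /\
  forall (P : spectrum S) (Q : spectrum S'),
    f P = Some Q -> spec_set Q = push R (spec_set P).

(* Main.v *)
(* The complement of a maximal ideal disjoint from a round filter is a point of
   the spectrum, so [p ≺ q] makes [spec_open p] way below [spec_open q]: an open
   cover of [spec_open q] with no finite subfamily covering [spec_open p] would
   give an ideal avoiding a round filter between [p] and [q], hence a point of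
   [spec_open q] left uncovered. An irreducible closed set [C] is the closure of
   the point [{p | spec_open p meets C}]. A morphism pushes points to points,
   and then [phi R P = Some Q] just when [Q] is the push-forward of [P], from
   which functoriality follows. *)
Require Import Defs.
From mathcomp Require Import all_boot all_order.
From mathcomp Require Import all_classical topology_structure.

Set Implicit Arguments.
Unset Strict Implicit.
Unset Printing Implicit Defensive.

Import Order.Theory Order.Syntax Order.LatticeSyntax.

Local Open Scope classical_set_scope.
Local Open Scope order_scope.

(** * Filters and ideals in a join-semilattice *)

Section FiltersIdeals.
Context {d : Order.disp_t} {S : bJoinSemilatticeType d}.
Implicit Types F I : set S.

Lemma is_filterP F : is_filter F <->
  [/\ F !=set0, forall p q, F p -> p <= q -> F q &
      forall p q, F p -> F q -> exists r, [/\ F r, r <= p & r <= q]].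
Proof.
split=> [[F0 FP]|[F0 up dir]].
  split=> // [p q Fp pq|p q Fp Fq]; last exact/FP.
  by have [] : F p /\ F q by apply/FP; exists p.
split=> // p q; split=> [[]|[r [Fr rp rq]]]; first exact: dir.
by split; [exact: up rp|exact: up rq].
Qed.

(** An upper bound in [I] of two elements dominates their join, so with binary joins directedness
    turns into closure under joins. *)
Lemma is_idealP I : is_ideal I <->
  [/\ I !=set0, forall p q, I q -> p <= q -> I p &
      forall p q, I p -> I q -> I (p `|` q)].
Proof.
split=> [[I0 IP]|[I0 down dir]].
  have down p q : I q -> p <= q -> I p.
    by move=> Iq pq; have [] : I p /\ I q by apply/IP; exists q.
  split=> // p q Ip Iq; have /IP [r [Ir pr qr]] := conj Ip Iq.
  by apply: down Ir _; rewrite leUx pr.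
split=> // p q; split=> [[Ip Iq]|[r [Ir pr qr]]].
  by exists (p `|` q); rewrite leUl leUr; split=> //; exact: dir.
by split; [exact: down pr|exact: down qr].
Qed.

(* The alternative [J = set0] provides an upper bound for the empty chain. *)
Lemma maximal_disjoint_ideal I F : is_ideal I -> (forall p, I p -> ~ F p) ->
  exists J, [/\ is_ideal J, (I `<=` J)%classic, forall p, J p -> ~ F p &
    forall K, is_ideal K -> (J `<=` K)%classic -> (forall p, K p -> ~ F p) ->
      (K `<=` J)%classic].
Proof.
move=> iI dI.
pose ok J := [/\ is_ideal J, (I `<=` J)%classic & forall p, J p -> ~ F p].
have [|J [okJ maxJ]] := @Zorn_bigcup _ [set J | J = set0 \/ ok J].
  move=> C Cok tC; have [[J [CJ J0]]|C0] :=
    pselect (exists J, C J /\ J !=set0); last first.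
    left; apply/seteqP; split=> // x [J CJ Jx]; apply: C0.
    by exists J; split=> //; exists x.
  have ok1 K x : C K -> K x -> ok K.
    by move=> CK Kx; case: (Cok K CK) => // K0; rewrite K0 in Kx.
  have [x Jx] := J0; have [iJ IJ dJ] := ok1 _ _ CJ Jx.
  right; split.
  - apply/is_idealP; split; first by exists x, J.
      move=> p q [K CK Kq] pq; exists K => //.
      by have [/is_idealP[_ down _] _ _] := ok1 _ _ CK Kq; exact: down pq.
    move=> p q [K CK Kp] [L CL Lq].
    have [KL|LK] := tC _ _ CK CL.
      exists L => //; have [/is_idealP[_ _ +] _ _] := ok1 _ _ CL Lq.
      by apply=> //; exact: KL.
    exists K => //; have [/is_idealP[_ _ +] _ _] := ok1 _ _ CK Kp.
    by apply=> //; exact: LK.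
  - by move=> p Ip; exists J => //; exact: IJ.
  - by move=> p [K CK Kp]; have [_ _] := ok1 _ _ CK Kp; exact.
have {}maxJ K : ok K -> (J `<=` K)%classic -> (K `<=` J)%classic.
  move=> okK JK; apply: contrapT => KJ.
  by apply: (maxJ K); [split|right].
have {}okJ : ok J.
  case: okJ => // J0; have okI : ok I by split.
  have [[p Ip] _] := iI.
  by have : J p; [apply: maxJ okI _ p Ip; rewrite J0|rewrite J0].
by have [iJ IJ dJ] := okJ; exists J; split=> // K iK JK dK;
  apply: maxJ => //; split=> //; exact: subset_trans IJ JK.
Qed.

End FiltersIdeals.

(** * Prime round filters of a predomain and their existence *)

Lemma prec_le (S : predomain) (p q : S) : p ≺ q -> p <= q.
Proof. by have [_] := prec_aux S; exact. Qed.

Lemma prec_le_trans (S : predomain) (p q r : S) : p ≺ q -> q <= r -> p ≺ r.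
Proof. by have [+ _] := prec_aux S; apply; exact: lexx. Qed.

(** An up-closed set is proper exactly when it omits [\bot]; then [\bot] lies in the complement,
    which is an ideal as soon as it is closed under joins. *)
Lemma in_spectrumP (S : predomain) (P : set S) : in_spectrum P <->
  [/\ [/\ P !=set0, forall p q, P p -> p <= q -> P q &
          forall p q, P p -> P q -> exists r, [/\ P r, r <= p & r <= q]],
      ~ P \bot, forall p q, P (p `|` q) -> P p \/ P q & is_round prec P].
Proof.
split=> [[[/is_filterP[P0 up dir] /is_idealP[_ _ Pj] Pp Pr]]|
  [[P0 up dir] nb Pj Pr]].
  split=> //; first by apply: contra_not Pp => Pb; apply/seteqP;
    split=> // p _; exact: up Pb (le0x p).
  by move=> p q; apply: contraPP => /not_orP[np nq]; exact: Pj.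
split=> //; last by move=> E; apply: nb; rewrite E.
split; first exact/is_filterP.
apply/is_idealP; split; first by exists \bot.
  by move=> p q nq pq Pp; apply: nq; exact: up Pp pq.
by move=> p q np nq /Pj[].
Qed.

(* Maximality of [J] makes every [a] outside [J] lie, modulo [J], above an
   element of [F]; distributivity then splits a lower element of [F] into a part
   [≺ a] and a part in [J], and the former cannot be in [J]. *)
Lemma prime_round_filter_separation (S : predomain) (I F : set S) :
  is_ideal I -> is_filter F -> is_round prec F -> (forall p, I p -> ~ F p) ->
  exists P, [/\ in_spectrum P, (F `<=` P)%classic & forall p, I p -> ~ P p].
Proof.
move=> iI /is_filterP[F0 upF dirF] rF dI.
have [J [/is_idealP[[j0 Jj0] dJ jJ] IJ disJ maxJ]] :=
  maximal_disjoint_ideal iI dI.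
have large a : ~ J a -> exists f j, [/\ F f, J j & f <= a `|` j].
  move=> nJa; apply: contrapT => no; apply: nJa.
  apply: (maxJ [set x | exists2 j, J j & x <= a `|` j]).
  - apply/is_idealP; split; first by exists j0, j0 => //; exact: leUr.
      by move=> p q [j Jj qj] pq; exists j => //; exact: le_trans qj.
    move=> p q [j Jj pj] [k Jk qk]; exists (j `|` k); first exact: jJ.
    rewrite leUx; apply/andP; split.
      by apply: le_trans pj _; apply: leU2 => //; exact: leUl.
    by apply: le_trans qk _; apply: leU2 => //; exact: leUr.
  - by move=> p Jp; exists p => //; exact: leUr.
  - by move=> p [j Jj pj] Fp; apply: no; exists p, j.
  - by exists j0 => //; exact: leUl.
have low a f j : ~ J a -> F f -> J j -> f <= a `|` j ->
    exists a', [/\ ~ J a', a' ≺ a & a' ≺ f].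
  move=> nJa Ff Jj fa.
  (* Distributivity takes two steps down in [F]: [f1] is the element split along [a] and [j], and
     [f2] is the one covered by the parts. If [a'] were in [J], so would be [f2]. *)
  have [f1 Ff1 f1f] := rF _ Ff; have [f2 Ff2 f21] := rF _ Ff1.
  have [a' [j' [a'a j'j f2le lef1]]] := prec_distr (prec_le_trans f1f fa) f21.
  exists a'; split=> //.
    move=> Ja'; apply: (disJ f2) => //; apply: (dJ _ _ _ f2le); apply: jJ => //.
    exact: dJ Jj (prec_le j'j).
  have [aux _] := prec_aux S; apply: aux f1f (lexx _).
  exact: le_trans (leUl _ _) lef1.
have rnd a : ~ J a -> exists2 r, ~ J r & r ≺ a.
  move=> nJa; have [f [j [Ff Jj fa]]] := large _ nJa.
  by have [r [nJr ra _]] := low _ _ _ nJa Ff Jj fa; exists r.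
exists (~` J)%classic; split; last by move=> p /IJ Jp; exact.
- apply/in_spectrumP; split=> //.
  + split; first by have [f Ff] := F0; exists f => /disJ.
      by move=> p q nJp pq Jq; apply: nJp; exact: dJ pq.
    move=> a b nJa nJb.
    have [f [j [Ff Jj fa]]] := large _ nJa.
    have [g [k [Fg Jk gb]]] := large _ nJb.
    have [h [Fh hf hg]] := dirF _ _ Ff Fg.
    have [a1 [nJa1 a1a a1h]] := low _ _ _ nJa Fh Jj (le_trans hf fa).
    have [a2 nJa2 a21] := rnd _ nJa1.
    (* A second splitting, now of an element already below [a]: its part below [b] stays below [a]
       and outside [J], hence is the common lower bound. *)
    have a1bk : a1 ≺ b `|` k := prec_le_trans a1h (le_trans hg gb).
    have [b' [k' [b'b k'k a2le lea1]]] := prec_distr a1bk a21.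
    exists b'; split; last exact: prec_le.
      move=> Jb'; apply: nJa2; apply: (dJ _ _ _ a2le); apply: jJ => //.
      exact: dJ Jk (prec_le k'k).
    exact: le_trans (le_trans (leUl _ _) lea1) (prec_le a1a).
  + by apply; exact: dJ Jj0 (le0x _).
  + move=> p q npq; apply/not_andP => -[Jp Jq].
    by apply: npq; exact: jJ.
- by move=> p Fp /disJ.
Qed.

(** Repeated interpolation gives a [≺]-descending sequence from [q] that stays above [p]; its upward
    closure is the filter. The subtype [X] carries the invariant [p ≺ x] through dependent
    choice. *)
Lemma round_filter_between (S : predomain) (p q : S) : p ≺ q ->
  exists F : set S, [/\ is_filter F, is_round prec F, F q &
    forall r, F r -> p <= r].
Proof.
move=> pq; pose X := {x : S | p ≺ x}.
have step (x : X) : {y : X | sval y ≺ sval x}.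
  apply: cid; have [y [py yx]] := prec_interp (proj2_sig x).
  by exists (exist _ y py).
have [f [f0 fS]] := dependent_choice step (exist _ q pq).
have fdec m n : sval (f (m + n)%N) <= sval (f m).
  elim: n => [|n]; first by rewrite addn0.
  by apply: le_trans; rewrite addnS; exact: prec_le.
exists [set s | exists n, sval (f n) <= s]; split.
- apply/is_filterP; split; first by exists q, 0; rewrite f0.
    by move=> r s [n fr] rs; exists n; exact: le_trans rs.
  move=> r s [m mr] [n ns]; exists (sval (f (m + n)%N)); split.
  + by exists (m + n)%N.
  + exact: le_trans (fdec _ _) mr.
  + by rewrite addnC; exact: le_trans (fdec _ _) ns.
- move=> r [n nr]; exists (sval (f n.+1)); first by exists n.+1.
  exact: prec_le_trans (fS n) nr.
- by exists 0; rewrite f0.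
- by move=> r [n]; apply: le_trans; exact: prec_le (proj2_sig (f n)).
Qed.

(** * The spectrum: its basis, core compactness and sobriety *)

Section Spectrum.
Variable S : predomain.
Implicit Types (P Q : spectrum S) (p q : S).

Lemma spec_setP P : in_spectrum (spec_set P).
Proof. exact: proj2_sig. Qed.

Lemma spec_set_inj : injective (@spec_set S).
Proof. by move=> P Q; exact: eq_sig_hprop => A; exact: Prop_irrelevance. Qed.

Lemma spec_set_neq0 P : spec_set P !=set0.
Proof. by have /in_spectrumP[[]] := spec_setP P. Qed.

Lemma spec_set_up P p q : spec_set P p -> p <= q -> spec_set P q.
Proof. by have /in_spectrumP[[_ up _] _ _ _] := spec_setP P; exact: up. Qed.

Lemma spec_set_dir P p q : spec_set P p -> spec_set P q ->
  exists r, [/\ spec_set P r, r <= p & r <= q].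
Proof. by have /in_spectrumP[[_ _ dir] _ _ _] := spec_setP P; exact: dir. Qed.

Lemma spec_set_round P p : spec_set P p -> exists2 r, spec_set P r & r ≺ p.
Proof. by have /in_spectrumP[_ _ _] := spec_setP P; exact. Qed.

Lemma spec_set_bot P : ~ spec_set P \bot.
Proof. by have /in_spectrumP[] := spec_setP P. Qed.

Lemma spec_set_join P p q :
  spec_set P (p `|` q) <-> spec_set P p \/ spec_set P q.
Proof.
split; first by have /in_spectrumP[_ _ + _] := spec_setP P; exact.
by case=> /spec_set_up; apply; [exact: leUl|exact: leUr].
Qed.

Lemma spec_open_bot : spec_open (\bot : S) = set0.
Proof. by apply/seteqP; split=> // P /spec_set_bot. Qed.

Lemma spec_open_join p q :
  spec_open (p `|` q) = (spec_open p `|` spec_open q)%classic.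
Proof. by apply/seteqP; split=> P /spec_set_join. Qed.

Lemma spec_open_le p q : p <= q -> (spec_open p `<=` spec_open q)%classic.
Proof. by move=> pq P Pp; exact: spec_set_up pq. Qed.

Lemma spec_open_open p : open (spec_open p).
Proof.
(* Openness in the generated topology unfolds to being a union of finite intersections of subbasic
   sets. *)
have H : exists2 D : set (set (spectrum S)),
    (D `<=` finI_from (@spec_basis S) id)%classic &
    (\bigcup_(A in D) A)%classic = spec_open p.
  exists [set spec_open p] => [A ->|]; last by rewrite bigcup_set1.
  by apply: (@finI_from1 _ _ _ id); exists p.
exact: H.
Qed.

(** Points are down-directed and non-empty, so finite intersections, the empty one included, can be
    shrunk to a single [spec_open p] around [P]: the subbasis is a basis. *)
Lemma spec_open_nbhs P (A : set (spectrum S)) : open A -> A P ->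
  exists2 p, spec_set P p & (spec_open p `<=` A)%classic.
Proof.
move=> oA.
have [D DI <-] : exists2 D : set (set (spectrum S)),
    (D `<=` finI_from (@spec_basis S) id)%classic &
    (\bigcup_(A in D) A)%classic = A := oA.
case=> B DB BP; suff [p Pp pB] : exists2 p, spec_set P p &
    (spec_open p `<=` B)%classic.
  by exists p => //; apply: subset_trans pB _; exact: bigcup_sup.
have [E EB BE] := DI _ DB; move: BP; rewrite -BE bigcap_fset big_seq.
elim/big_ind: _ => [_|B1 B2 IH1 IH2 [/IH1[p Pp pB] /IH2[q Pq qB]]|B' BE'].
- by have [p Pp] := spec_set_neq0 P; exists p.
- have [r [Pr rp rq]] := spec_set_dir Pp Pq; exists r => // Q Qr.
  by split; [apply: pB|apply: qB]; exact: spec_open_le Qr.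
- by have := EB _ BE'; rewrite inE => -[p _ <-]; exists p.
Qed.

Lemma spec_cup_basis : cup_basis (@spec_basis S).
Proof.
split; first split.
- by move=> _ [p _ <-]; exact: spec_open_open.
- move=> P A; rewrite nbhsE => -[B [oB BP] BA].
  have [p Pp pB] := spec_open_nbhs oB BP.
  by exists (spec_open p); [split=> //; exists p|exact: subset_trans BA].
move=> F fF FB; rewrite -bigsetU_fset_set// big_seq.
elim/big_ind: _ => [|_ _ [p _ <-] [q _ <-]|A].
- by exists \bot => //; exact: spec_open_bot.
- by exists (p `|` q) => //; exact: spec_open_join.
- by rewrite in_fset_set// inE; exact: FB.
Qed.

Lemma spec_core_compact : core_compact (spectrum S).
Proof.
move=> P O oO OP.
have [q Pq qO] := spec_open_nbhs oO OP.
have [p Pp pq] := spec_set_round Pq.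
exists (spec_open p); split=> //; first exact: spec_open_open.
move=> U Uo OU.
(* The ideal of elements whose basic open set has a finite subcover from [U]; the goal becomes
   membership of [p]. *)
pose I : set S := [set s | exists V : set (set (spectrum S)),
  [/\ finite_set V, (V `<=` U)%classic &
     (spec_open s `<=` \bigcup_(A in V) A)%classic]].
change (I p); apply: contrapT => nIp.
have iI : is_ideal I.
  apply/is_idealP; split.
  - by exists \bot, set0; split=> //; rewrite spec_open_bot.
  - move=> r s [V [fV VU sV]] rs; exists V; split=> //.
    exact: subset_trans (spec_open_le rs) sV.
  - move=> r s [V [fV VU rV]] [W [fW WU sW]]; exists (V `|` W)%classic.
    split; first by rewrite finite_setU.
      by rewrite subUset.
    by rewrite spec_open_join bigcup_setU; exact: setUSS.
have [F [iF rF Fq Fp]] := round_filter_between pq.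
have [|Q [sQ FQ IQ]] := prime_round_filter_separation iI iF rF.
  move=> r [V [fV VU rV]] /Fp pr; apply: nIp; exists V; split=> //.
  exact: subset_trans (spec_open_le pr) rV.
pose Q' : spectrum S := exist _ Q sQ.
have [A UA AQ] : (\bigcup_(A in U) A)%classic Q'.
  by apply: OU; apply: qO; exact: FQ.
(* The single set [A] already covers [spec_open r], so [r] is in both [I] and [Q], a
   contradiction. *)
have [r Qr rA] := spec_open_nbhs (Uo _ UA) AQ.
apply: (IQ r) Qr; exists [set A]; split=> //; first by move=> _ ->.
by rewrite bigcup_set1.
Qed.

(** The sets [spec_open q] with [q] in [Q] form a neighbourhood base at [Q], and [P] lies in all of
    them exactly when it contains [Q]. *)
Lemma closure_spec P Q :
  closure [set P] Q <-> (spec_set Q `<=` spec_set P)%classic.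
Proof.
split=> [cQ p Qp|QP A].
  have [_ [->]] : ([set P] `&` spec_open p !=set0)%classic.
    by apply: cQ; apply: open_nbhs_nbhs; split=> //; exact: spec_open_open.
  exact.
rewrite nbhsE => -[B [oB BQ] BA]; have [q Qq qB] := spec_open_nbhs oB BQ.
by exists P; split=> //; apply: BA; apply: qB; exact: QP.
Qed.

(** Irreducibility in terms of open sets: if [C] missed the intersection, the two closed complements
    would cover it. *)
Lemma irreducible_openI (X : topologicalType) (C A B : set X) :
  irreducible_set C -> open A -> open B ->
  (C `&` A !=set0)%classic -> (C `&` B !=set0)%classic ->
  (C `&` (A `&` B) !=set0)%classic.
Proof.
move=> irrC oA oB [x [Cx Ax]] [y [Cy By]]; apply: contrapT => nAB.
have [||z Cz|CA|CB] := irrC (~` A)%classic (~` B)%classic.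
- exact: open_closedC.
- exact: open_closedC.
- by apply/not_andP => ABz; apply: nAB; exists z.
- exact: CA Cx Ax.
- exact: CB Cy By.
Qed.

Lemma spec_sober : sober (spectrum S).
Proof.
move=> C cC [P0 CP0] irrC.
pose G : set S := [set p | (C `&` spec_open p !=set0)%classic].
have sG : in_spectrum G.
  apply/in_spectrumP; split.
  - split.
    + by have [p P0p] := spec_set_neq0 P0; exists p, P0.
    + by move=> p q [P [CP Pp]] pq; exists P; split=> //; exact: spec_open_le Pp.
    (* Only directedness needs irreducibility: it puts [p] and [q] into one common point of [C]. The
       other clauses pass from single points to their union [G]. *)
    + move=> p q Gp Gq.
      have [P [CP [Pp Pq]]] :=
        irreducible_openI irrC (spec_open_open p) (spec_open_open q) Gp Gq.
      by have [r [Pr rp rq]] := spec_set_dir Pp Pq; exists r; split=> //; exists P.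
  - by case=> P [_ /spec_set_bot].
  - by move=> p q [P [CP /spec_set_join[Pp|Pq]]]; [left|right]; exists P.
  - by move=> p [P [CP /spec_set_round[r Pr rp]]]; exists r => //; exists P.
exists (exist _ G sG); split.
  apply/seteqP; split=> [P CP|P /closure_spec PG].
    by apply/closure_spec => p Pp; exists P.
  rewrite ((closure_id C).1 cC) => A; rewrite nbhsE => -[B [oB BP] BA].
  have [p Pp pB] := spec_open_nbhs oB BP.
  by have [Q [CQ Qp]] := PG _ Pp; exists Q; split=> //; apply: BA; exact: pB.
(* A generic point [Q] contains every point of [C] and belongs to [C], so it is their union [G]. *)
move=> Q CQ; apply: spec_set_inj; apply/seteqP; split=> p /=.
  case=> P [CP Pp]; rewrite CQ in CP.
  by have /closure_spec := CP; exact.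
move=> Qp; exists Q; split=> //; rewrite CQ; exact: subset_closure.
Qed.

Lemma spec_is_cup_base : is_cup_base (@spec_basis S).
Proof.
by split; [exact: spec_core_compact|exact: spec_sober|exact: spec_cup_basis].
Qed.

End Spectrum.

(** * The partial continuous map induced by a morphism *)

Section Push.
Variables (S S' : predomain) (R : pd_morphism S S').

(** Pushforward gives directedness and roundness, auxiliarity upward closure, faithfulness
    properness, and join-pullback primeness. Non-emptiness must be assumed, whence the partiality of
    [phi]. *)
Lemma push_in_spectrum (P : spectrum S) :
  push R (spec_set P) !=set0 -> in_spectrum (push R (spec_set P)).
Proof.
move=> P0; have [Rf Ra Rp Rj] := pd_relP R.
have dir p' q' : push R (spec_set P) p' -> push R (spec_set P) q' ->
    exists r', [/\ push R (spec_set P) r', r' ≺ p' & r' ≺ q'].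
  move=> [p Pp pp'] [q Pq qq'].
  have [r [Pr rp rq]] := spec_set_dir Pp Pq.
  have [s Ps sr] := spec_set_round Pr.
  have rp' : R r p' by exact: Ra rp pp' (lexx _).
  have rq' : R r q' by exact: Ra rq qq' (lexx _).
  have [r' [sr' r'p r'q]] := Rp _ _ _ _ sr rp' rq'.
  by exists r'; split=> //; exists s.
apply/in_spectrumP; split; first split=> //.
- by move=> p' q' [p Pp pp'] p'q'; exists p => //; exact: Ra (lexx _) pp' p'q'.
- move=> p' q' /dir Pp' /Pp' [r' [Pr' /prec_le rp /prec_le rq]].
  by exists r'.
- by case=> p Pp /Rf p0; move: Pp; rewrite p0; exact: spec_set_bot.
- move=> p' q' [p Pp pp'q']; have [u Pu up] := spec_set_round Pp.
  have [r [s [rp' sq' urs]]] := Rj _ _ _ _ up pp'q'.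
  have /spec_set_join[Pr|Ps] := spec_set_up Pu (prec_le urs).
    by left; exists r.
  by right; exists s.
- by move=> p' Pp'; have [r' [Pr' rp _]] := dir _ _ Pp' Pp'; exists r'.
Qed.

Definition phi (P : spectrum S) : option (spectrum S') :=
  if pselect (push R (spec_set P) !=set0) is left P0
  then Some (exist _ _ (push_in_spectrum P0)) else None.

(** Since points are non-empty, the equation of sets on the right already forces [P] into the
    domain. *)
Lemma phiP (P : spectrum S) (Q : spectrum S') :
  phi P = Some Q <-> spec_set Q = push R (spec_set P).
Proof.
rewrite /phi; case: pselect => [P0|P0]; split=> //.
- by case=> <-.
- by move=> QP; congr Some; exact: spec_set_inj.
- by move=> QP; case: P0; rewrite -QP; exact: spec_set_neq0.
Qed.

Lemma phi_is_phi : is_phi R phi.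
Proof.
split=> [|P Q /phiP//]; apply/seteqP; split=> P.
  by case=> Q /phiP QP; rewrite /= -QP; exact: spec_set_neq0.
by move=> P0; exists (exist _ _ (push_in_spectrum P0)); exact/phiP.
Qed.

(** A [p] in [P] related to [q] witnesses both that [phi] is defined at [P] and that its value
    contains [q]; continuity follows. *)
Lemma ppreimage_phi (q : S') : ppreimage phi (spec_open q) =
  (\bigcup_(p in [set p | R p q]) spec_open p)%classic.
Proof.
apply/seteqP; split=> [P [Q /phiP QP]|P [p pq Pp]].
  by rewrite /spec_open /= QP => -[p Pp pq]; exists p.
have Pq : push R (spec_set P) q by exists p.
by exists (exist _ _ (push_in_spectrum (ex_intro _ _ Pq))) => //; exact/phiP.
Qed.

Lemma phi_is_cb_morphism : is_cb_morphism
  (S := CupBase (spec_is_cup_base S)) (S' := CupBase (spec_is_cup_base S')) phi.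
Proof.
apply/is_cb_morphismP => _ [q _ <-]; rewrite ppreimage_phi.
by apply: bigcup_open => p _; exact: spec_open_open.
Qed.

End Push.

(** * Functoriality *)

Lemma push_id (S : predomain) (P : spectrum S) :
  push (pd_id S) (spec_set P) = spec_set P.
Proof.
apply/seteqP; split=> [q [p Pp pq]|p Pp]; first exact: spec_set_up pq.
by exists p => //=.
Qed.

Lemma push_comp (A B C : predomain) (f : A -> B -> Prop) (g : B -> C -> Prop)
    (P : set A) : push (comp_rel f g) P = push g (push f P).
Proof.
apply/seteqP; split=> [c [a Pa [b [fab gbc]]]|c [b [a Pa fab] gbc]].
  by exists b => //; exists a.
by exists a => //; exists b.
Qed.

Lemma phi_id (S : predomain) (P : spectrum S) : phi (pd_id S) P = Some P.
Proof. by apply/phiP; rewrite push_id. Qed.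

Lemma phi_comp (S1 S2 S3 : predomain) (f : pd_morphism S1 S2)
    (g : pd_morphism S2 S3) (P : spectrum S1) :
  phi (pd_comp f g) P = obind (phi g) (phi f P).
Proof.
case fP: (phi f P) => [Q|] /=.
  case gQ: (phi g Q) => [T|].
    by apply/phiP; move/phiP: gQ => ->; rewrite push_comp; move/phiP: fP => ->.
  case fgP: (phi (pd_comp f g) P) => [T|//].
  by rewrite -gQ; symmetry; apply/phiP; move/phiP: fgP => ->;
    rewrite push_comp; move/phiP: fP => ->.
case fgP: (phi (pd_comp f g) P) => [T|//].
(* An element of [T] factors through some [b] in the push-forward of [P] along [f], so [phi f P]
   would be defined. *)
have [r] := spec_set_neq0 T; move/phiP: fgP => ->; rewrite push_comp.
case=> b fPb _; have P0 : push f (spec_set P) !=set0 by exists b.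
have : phi f P = Some (exist _ _ (push_in_spectrum P0)) by exact/phiP.
by rewrite fP.
Qed.

Theorem proposition3p3 :
  exists (H : forall S : predomain, is_cup_base (@spec_basis S))
         (Phi : forall S S' : DvP,
            hom S S' -> hom (spec_obj H S) (spec_obj H S')),
    is_functor Phi /\
    forall (S S' : predomain) (R : pd_morphism S S'),
      is_phi R (cb_fun (Phi S S' R)).
Proof.
exists spec_is_cup_base.
exists (fun S S' R => CbMorphism (phi_is_cb_morphism R)).
split; last by move=> S S' R; exact: phi_is_phi.
split=> [S|S1 S2 S3 f g]; apply: cb_morphism_eq => P.
  exact: phi_id.
exact: phi_comp.
Qed.
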